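(* Let $N\ge2$ and $R=\mathbb Z_N[x_1^{\pm1},x_2^{\pm1},x_3^{\pm1}]$. For every regular sequence $\mathbf f=(f_1,f_2,f_3)\in R^3$ and every $\mathbf a\in R^3$, the model $\mathcal C_{\mathbf a}(\mathbf f;\mathbb Z_N)$ is a translation-invariant topological CSS code.
   Context: $R$ carries the $\mathbb Z_N$-linear involution $\overline{x^{\mathbf v}}=x^{-\mathbf v}$; for matrices $\varphi^\dagger=\overline\varphi^{\mathsf T}$. A sequence $(f_1,f_2,f_3)$ is regular if $f_1$ is a non-zero-divisor in $R$ and each $f_i$ ($i=2,3$) is a non-zero-divisor on $R/(f_1,\dots,f_{i-1})$. Koszul modules and differentials: $K_0=R$, $K_1=R^3$ (basis $e_1,e_2,e_3$), $K_2=R^3$ (basis $e_{23},e_{31},e_{12}$), $K_3=R$ (basis $e_{123}$), $$\partial_1=\begin{pmatrix} f_1 & f_2 & f_3 \end{pmatrix},\quad \partial_2=\begin{pmatrix} 0 & f_3 & -f_2 \\ -f_3 & 0 & f_1 \\ f_2 & -f_1 & 0 \end{pmatrix},\quad \partial_3=\begin{pmatrix} f_1 \\ f_2 \\ f_3 \end{pmatrix}.$$ For a column vector $\mathbf a=(a_1,a_2,a_3)^{\mathsf T}\in R^3$, $\mathcal C_{\mathbf a}(\mathbf f;\mathbb Z_N)$ is given by $$\varphi_{Z,\mathbf a}=\begin{pmatrix} \partial_2 & \mathbf a \\ 0 & \partial_3 \end{pmatrix}:K_2\oplus K_3\to K_1\oplus K_2,\qquad \varphi_{X,\mathbf a}=\begin{pmatrix}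 \partial_1 & -\mathbf a^{\mathsf T} \\ 0 & \partial_2 \end{pmatrix}^{\dagger}=\begin{pmatrix} \partial_1^\dagger & 0 \\ -\overline{\mathbf a} & \partial_2^\dagger \end{pmatrix}.$$ A pair $(\varphi_X,\varphi_Z)$ of matrices with the same number of rows is a (translation-invariant) CSS code if $\varphi_X^\dagger\varphi_Z=0$, and is topological if $\operatorname{im}\varphi_X=\ker\varphi_Z^\dagger$ and $\operatorname{im}\varphi_Z=\ker\varphi_X^\dagger$. *)

(* Defs.v *)
From HB Require Import structures.
From mathcomp Require Import all_boot all_order all_algebra finmap.
From mathcomp.multinomials Require Import xfinmap monalg.

Set Implicit Arguments.
Unset Strict Implicit.
Unset Printing Implicit Defensive.

Import GRing.Theory.

Local Open Scope fset.
Local Open Scope ring_scope.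

(* R[x_1^{±1}, ..., x_n^{±1}], as finitely supported functions from exponent
   vectors in Z^n to R; << c *g v >> is c x^v.  The multiplication of monalg is
   not available here: a [monomType] has no unit other than 1, which excludes
   the group Z^n. *)
Definition laurent (R : comNzRingType) (n : nat) : predArgType :=
  {malg R['rV[int]_n]}.

Section LaurentRing.
Variables (R : comNzRingType) (n : nat).
Local Notation L := (laurent R n).
Implicit Types g : L.

HB.instance Definition _ := GRing.Lmodule.on L.

Definition laurent_one : L := << 1 *g 0 >>.

Definition laurent_mul g1 g2 : L :=
  \sum_(v <- msupp g1) \sum_(w <- msupp g2) << g1@_v * g2@_w *g (v + w)%R >>.

Let mulEw (d1 d2 : {fset 'rV[int]_n}) g1 g2 :
    msupp g1 `<=` d1 -> msupp g2 `<=` d2 ->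
  laurent_mul g1 g2 =
    \sum_(v <- d1) \sum_(w <- d2) << g1@_v * g2@_w *g (v + w)%R >>.
Proof.
move=> le1 le2; rewrite /laurent_mul (big_fset_incl _ le1) /=.
  apply: eq_bigr => v _; apply: big_fset_incl => // w _ /mcoeff_outdom ->.
  by rewrite mulr0 monalgU0.
move=> v _ /mcoeff_outdom g1v; rewrite big1 // => w _.
by rewrite g1v mul0r monalgU0.
Qed.

Lemma laurent_mulUU (c1 c2 : R) (v w : 'rV[int]_n) :
  laurent_mul << c1 *g v >> << c2 *g w >> = << c1 * c2 *g (v + w)%R >>.
Proof. by rewrite (mulEw msuppU_le msuppU_le) !big_seq_fset1 !mcoeffUU. Qed.

Fact laurent_mulC : commutative laurent_mul.
Proof.
move=> g1 g2; rewrite /laurent_mul exchange_big; apply: eq_bigr => w _.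
by apply: eq_bigr => v _; rewrite mulrC addrC.
Qed.

Fact laurent_mulDl : left_distributive laurent_mul +%R.
Proof.
move=> g1 g2 g.
rewrite (mulEw (msuppD_le g1 g2) (fsubset_refl _)).
rewrite (mulEw (fsubsetUl (msupp g1) (msupp g2)) (fsubset_refl _)).
rewrite (mulEw (fsubsetUr (msupp g1) (msupp g2)) (fsubset_refl _)).
rewrite -big_split /=; apply: eq_bigr => v _.
rewrite -big_split /=; apply: eq_bigr => w _.
by rewrite mcoeffD mulrDl monalgUD.
Qed.

Let mulDr : right_distributive laurent_mul +%R.
Proof.
by move=> g g1 g2; rewrite laurent_mulC laurent_mulDl !(laurent_mulC _ g).
Qed.

Let mul0g g : laurent_mul 0 g = 0.
Proof. by rewrite /laurent_mul msupp0 big_seq_fset0. Qed.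

Let mulg0 g : laurent_mul g 0 = 0.
Proof. by rewrite laurent_mulC mul0g. Qed.

Fact laurent_mul1 : left_id laurent_one laurent_mul.
Proof.
move=> g; rewrite (mulEw msuppU_le (fsubset_refl _)) big_seq_fset1.
rewrite [RHS]monalgE; apply: eq_bigr => v _.
by rewrite mcoeffUU mul1r add0r.
Qed.

Fact laurent_mulA : associative laurent_mul.
Proof.
have suml I (r : seq I) (F : I -> L) g :
    laurent_mul (\sum_(i <- r) F i) g = \sum_(i <- r) laurent_mul (F i) g.
  exact: (big_morph (laurent_mul^~ g) (fun _ _ => laurent_mulDl _ _ _)).
have sumr I (r : seq I) (F : I -> L) g :
    laurent_mul g (\sum_(i <- r) F i) = \sum_(i <- r) laurent_mul g (F i).
  exact: (big_morph (laurent_mul g) (fun _ _ => mulDr _ _ _)).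
move: laurent_mul laurent_mulUU suml sumr => mul mulUU suml sumr g1 g2 g3.
rewrite [g1]monalgE [g2]monalgE [g3]monalgE.
rewrite !suml; apply: eq_bigr => u _.
rewrite [LHS]sumr [mul << _ *g u >> _ in RHS]sumr suml; apply: eq_bigr => v _.
by rewrite !sumr; apply: eq_bigr => w _; rewrite !mulUU mulrA addrA.
Qed.

Fact laurent_one_neq0 : laurent_one != 0.
Proof. by rewrite monalgU_eq0 oner_eq0. Qed.

HB.instance Definition _ := GRing.Zmodule_isComNzRing.Build L
  laurent_mulA laurent_mulC laurent_mul1 laurent_mulDl laurent_one_neq0.

Lemma laurentMUU (c1 c2 : R) (v w : 'rV[int]_n) :
  (<< c1 *g v >> : L) * << c2 *g w >> = << c1 * c2 *g (v + w)%R >>.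
Proof. exact: laurent_mulUU. Qed.

(* The R-linear extension of x^v |-> x^{-v}. *)
Definition laurent_conj g : L := \sum_(v <- msupp g) << g@_v *g (- v)%R >>.

Lemma laurent_conjU (c : R) (v : 'rV[int]_n) :
  laurent_conj << c *g v >> = << c *g (- v)%R >>.
Proof.
rewrite /laurent_conj msuppU; have [->|_] := eqVneq c 0.
  by rewrite big_seq_fset0 monalgU0.
by rewrite big_seq_fset1 mcoeffUU.
Qed.

Lemma mcoeff_laurent_conj g (v : 'rV[int]_n) :
  (laurent_conj g)@_v = g@_(- v)%R.
Proof.
rewrite /laurent_conj raddf_sum [in RHS](monalgE g) raddf_sum.
by apply: eq_bigr => w _; rewrite /= !mcoeffU eqr_oppLR.
Qed.

Definition dagger m p (A : 'M[L]_(m, p)) : 'M[L]_(p, m) :=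
  (map_mx laurent_conj A)^T.

(* C = (phi_X, phi_Z); translation invariance on the lattice Z^n is encoded by
   the entries being Laurent polynomials. *)
Definition css_code m p q (C : 'M[L]_(m, p) * 'M[L]_(m, q)) : Prop :=
  dagger C.1 *m C.2 = 0.

Definition mx_im m p (A : 'M[L]_(m, p)) (v : 'cV[L]_m) : Prop :=
  exists u : 'cV[L]_p, v = A *m u.

Definition mx_ker m p (A : 'M[L]_(m, p)) (v : 'cV[L]_p) : Prop := A *m v = 0.

Definition topological m p q (C : 'M[L]_(m, p) * 'M[L]_(m, q)) : Prop :=
  (forall v, mx_im C.1 v <-> mx_ker (dagger C.2) v) /\
  (forall v, mx_im C.2 v <-> mx_ker (dagger C.1) v).

End LaurentRing.

Section Koszul.
Variable A : comNzRingType.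

Definition ideal_gen (s : seq A) (x : A) : Prop :=
  exists c : 'I_(size s) -> A, x = \sum_i c i * s`_i.

(* f is a non-zero-divisor on A/(s): f g = 0 in A/(s) implies g = 0 in A/(s). *)
Definition nonzerodivisor_mod (s : seq A) (f : A) : Prop :=
  forall g : A, ideal_gen s (f * g) -> ideal_gen s g.

(* No condition A/(f1, f2, f3) != 0 is imposed. *)
Definition regular_sequence (f1 f2 f3 : A) : Prop :=
  [/\ GRing.lreg f1,
      nonzerodivisor_mod [:: f1] f2
    & nonzerodivisor_mod [:: f1; f2] f3].

Definition mx_of_rows m n (s : seq (seq A)) : 'M[A]_(m, n) :=
  \matrix_(i < m, j < n) (nth [::] s i)`_j.

(* Bases: e_1, e_2, e_3 of K_1 and e_23, e_31, e_12 of K_2. *)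
Definition koszul1 (f1 f2 f3 : A) : 'M[A]_(1, 3) :=
  mx_of_rows 1 3 [:: [:: f1; f2; f3]].

Definition koszul2 (f1 f2 f3 : A) : 'M[A]_(3, 3) :=
  mx_of_rows 3 3 [:: [::   0;  f3; -f2];
                     [:: -f3;   0;  f1];
                     [::  f2; -f1;   0]].

Definition koszul3 (f1 f2 f3 : A) : 'M[A]_(3, 1) :=
  mx_of_rows 3 1 [:: [:: f1]; [:: f2]; [:: f3]].

End Koszul.

Section TwistedKoszulCode.
Variables (R : comNzRingType) (n : nat).
Local Notation L := (laurent R n).

Definition phiZ (f1 f2 f3 : L) (a : 'cV[L]_3) : 'M[L]_(3 + 3, 3 + 1) :=
  block_mx (koszul2 f1 f2 f3) a
           0                  (koszul3 f1 f2 f3).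

Definition phiX (f1 f2 f3 : L) (a : 'cV[L]_3) : 'M[L]_(3 + 3, 1 + 3) :=
  dagger (block_mx (koszul1 f1 f2 f3) (- a^T)
                   0                  (koszul2 f1 f2 f3)).

Definition twisted_koszul_code (f1 f2 f3 : L) (a : 'cV[L]_3) :=
  (phiX f1 f2 f3 a, phiZ f1 f2 f3 a).

End TwistedKoszulCode.

(* Main.v *)
(** The Koszul complex of a regular sequence is exact in degrees 1 and 2, and
    it is self-dual: transposition exchanges [koszul1] with [koszul3] and
    negates [koszul2].  The twist by [a] respects the differentials because
    [koszul1 *m a = a^T *m koszul3], so both kernels are computed by solving
    first for the untwisted block and then for the remaining one.  Conjugating
    entrywise by the involution turns daggers into transposes. *)
From HB Require Import structures.
Require Import Defs.
From mathcomp Require Import all_boot all_order all_algebra finmap.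
From mathcomp Require Import ring.
From mathcomp.multinomials Require Import monalg.

Import GRing.Theory.

Local Open Scope ring_scope.

Section LaurentConj.
Context {R : comNzRingType} {n : nat}.
Local Notation L := (laurent R n).
Local Notation conj := (@laurent_conj R n).

Lemma laurent_conjK : involutive conj.
Proof. by move=> g; apply/malgP => v; rewrite !mcoeff_laurent_conj opprK. Qed.

(* [mcoeffB] and [monalgE] at the type [laurent R n], whose additive structure
   is convertible to that of [{malg _}] but too costly to unify with it. *)
Lemma mcoeff_laurentB (g h : L) v : (g - h)@_v = g@_v - h@_v.
Proof.
have malgB (g1 g2 : {malg R['rV[int]_n]}) : (g1 - g2)@_v = g1@_v - g2@_v.
  exact: mcoeffB.
exact: (malgB g h).
Qed.

Lemma laurentE (g : L) : g = \sum_(v <- msupp g) (<< g@_v *g v >> : L).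
Proof. exact: (monalgE (g : {malg R['rV[int]_n]})). Qed.

Lemma laurent_conj_is_zmod_morphism : zmod_morphism conj.
Proof.
move=> g h; apply/malgP => v.
apply: etrans (mcoeff_laurent_conj _ _) (etrans (mcoeff_laurentB g h _) _).
apply: esym; apply: etrans (mcoeff_laurentB (conj g) (conj h) v) _.
by congr (_ - _); apply: mcoeff_laurent_conj.
Qed.

HB.instance Definition _ :=
  GRing.isZmodMorphism.Build L L conj laurent_conj_is_zmod_morphism.

Lemma laurent_conj_is_monoid_morphism : monoid_morphism conj.
Proof.
split=> [|g h]; first by rewrite [LHS]laurent_conjU oppr0.
rewrite [g]laurentE [h]laurentE.
rewrite [in LHS]mulr_suml [LHS]raddf_sum [X in X * _]raddf_sum [RHS]mulr_suml.
apply: eq_bigr => v _; rewrite mulr_sumr [LHS]raddf_sum.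
rewrite [X in _ * X]raddf_sum [RHS]mulr_sumr; apply: eq_bigr => w _ /=.
rewrite laurentMUU [LHS]laurent_conjU.
by rewrite (laurent_conjU g@_v) (laurent_conjU h@_w) laurentMUU opprD.
Qed.

HB.instance Definition _ :=
  GRing.isMonoidMorphism.Build L L conj laurent_conj_is_monoid_morphism.

Lemma map_laurent_conjK m p : involutive (@map_mx L L conj m p).
Proof. by move=> A; apply/matrixP => i j; rewrite !mxE laurent_conjK. Qed.

Lemma daggerK m p (A : 'M[L]_(m, p)) : dagger (dagger A) = A.
Proof. by rewrite /dagger map_trmx trmxK map_laurent_conjK. Qed.

Lemma map_conj_dagger m p (A : 'M[L]_(m, p)) : map_mx conj (dagger A) = A^T.
Proof. by rewrite /dagger map_trmx map_laurent_conjK. Qed.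

Lemma mx_im_dagger m p (A : 'M[L]_(m, p)) (v : 'cV[L]_p) :
  mx_im (dagger A) v <-> exists u, map_mx conj v = A^T *m u.
Proof.
split=> [[u ->]|[u vE]]; exists (map_mx conj u).
  by rewrite map_mxM map_conj_dagger.
apply: (can_inj (map_laurent_conjK _ _)).
by rewrite vE map_mxM map_conj_dagger map_laurent_conjK.
Qed.

Lemma mx_ker_dagger m p (A : 'M[L]_(m, p)) (v : 'cV[L]_m) :
  mx_ker (dagger A) v <-> A^T *m map_mx conj v = 0.
Proof.
rewrite /mx_ker -map_conj_dagger -map_mxM.
split=> [->|Av0]; first exact: map_mx0.
by rewrite -[LHS]map_laurent_conjK Av0 map_mx0.
Qed.

End LaurentConj.

Section TwistedKoszul.
Context {A : comNzRingType}.
Context {f1 f2 f3 : A} {a : 'cV[A]_3}.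
Local Notation d1 := (koszul1 f1 f2 f3).
Local Notation d2 := (koszul2 f1 f2 f3).
Local Notation d3 := (koszul3 f1 f2 f3).

Lemma tr_koszul1 : d1^T = d3.
Proof. by apply/matrixP=> -[[|[|[|//]]] ?] [[|//] ?]; rewrite !mxE. Qed.

Lemma tr_koszul3 : d3^T = d1.
Proof. by rewrite -tr_koszul1 trmxK. Qed.

Lemma tr_koszul2 : d2^T = - d2.
Proof.
by apply/matrixP=> -[[|[|[|//]]] ?] [[|[|[|//]]] ?];
  rewrite !mxE /= ?opprK ?oppr0.
Qed.

Lemma forall_ord3 (P : 'I_3 -> Prop) :
  P ord0 -> P (lift ord0 ord0) -> P ord_max -> forall i, P i.
Proof.
move=> P0 P1 P2 [[|[|[|//]]] lti].
- by rewrite (_ : Ordinal lti = ord0) //; apply: val_inj.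
- by rewrite (_ : Ordinal lti = lift ord0 ord0) //; apply: val_inj.
- by rewrite (_ : Ordinal lti = ord_max) //; apply: val_inj.
Qed.

Lemma sum_ord3 (F : 'I_3 -> A) :
  \sum_i F i = F ord0 + F (lift ord0 ord0) + F ord_max.
Proof.
rewrite !big_ord_recl big_ord0 addr0 addrA.
by congr (_ + _ + F _); apply: val_inj.
Qed.

Lemma koszul1M {p} (B : 'M[A]_(3, p)) j :
  (d1 *m B) ord0 j =
    f1 * B ord0 j + f2 * B (lift ord0 ord0) j + f3 * B ord_max j.
Proof. by rewrite mxE sum_ord3 !mxE. Qed.

Lemma koszul2M {p} (B : 'M[A]_(3, p)) j :
  [/\ (d2 *m B) ord0 j = f3 * B (lift ord0 ord0) j - f2 * B ord_max j,
      (d2 *m B) (lift ord0 ord0) j = f1 * B ord_max j - f3 * B ord0 j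
    & (d2 *m B) ord_max j = f2 * B ord0 j - f1 * B (lift ord0 ord0) j].
Proof. by split; rewrite mxE sum_ord3 !mxE /=; ring. Qed.

Lemma koszul3M {p} (B : 'M[A]_(1, p)) j :
  [/\ (d3 *m B) ord0 j = f1 * B ord0 j,
      (d3 *m B) (lift ord0 ord0) j = f2 * B ord0 j
    & (d3 *m B) ord_max j = f3 * B ord0 j].
Proof. by split; rewrite mxE big_ord1 !mxE. Qed.

Lemma koszul12 : d1 *m d2 = 0.
Proof.
apply/matrixP => i j; rewrite (ord1 i) koszul1M !mxE.
by elim/forall_ord3: j => /=; ring.
Qed.

Lemma koszul23 : d2 *m d3 = 0.
Proof.
apply/matrixP => i j; rewrite (ord1 j) [RHS]mxE.
have [E1 E2 E3] := koszul2M d3 ord0.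
by elim/forall_ord3: i; rewrite ?E1 ?E2 ?E3 !mxE /=; ring.
Qed.

Lemma koszul1_twist : d1 *m a = a^T *m d3.
Proof.
by rewrite -tr_koszul1 -trmx_mul [d1 *m a]mx11_scalar tr_scalar_mx.
Qed.

Hypothesis reg : regular_sequence f1 f2 f3.

Lemma koszul2_exact (v : 'cV[A]_3) : d2 *m v = 0 ->
  exists c : 'M_1, v = d3 *m c.
Proof.
have [f1_reg f2_reg _] := reg => d2v.
have [] := koszul2M v 0; rewrite d2v !mxE => E1 E2 E3.
set v1 := v ord0 0 in E2 E3; set v2 := v _ 0 in E1 E3.
set v3 := v _ 0 in E1 E2.
have [|c] := f2_reg v1.
  exists (fun=> v2); rewrite big_ord1 /= [v2 * _]mulrC.
  by apply/eqP; rewrite -subr_eq0 -E3.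
rewrite big_ord1 /= => v1E.
have v2E : v2 = f2 * c ord0.
  apply: f1_reg; apply/eqP; rewrite -subr_eq0; apply/eqP.
  by rewrite -[RHS]oppr0 E3 v1E; ring.
have v3E : v3 = f3 * c ord0.
  apply: f1_reg; apply/eqP; rewrite -subr_eq0; apply/eqP.
  by rewrite E2 v1E; ring.
exists (const_mx (c ord0)); apply/matrixP => i j; rewrite (ord1 j).
have [K1 K2 K3] := koszul3M (const_mx (c ord0) : 'M_1) 0.
elim/forall_ord3: i; rewrite ?K1 ?K2 ?K3 !mxE //.
by rewrite mulrC.
Qed.

Lemma koszul1_exact (u : 'cV[A]_3) : d1 *m u = 0 -> exists w, u = d2 *m w.
Proof.
have [f1_reg f2_reg f3_reg] := reg => d1u.
have := koszul1M u 0; rewrite d1u mxE.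
set u1 := u ord0 0; set u2 := u _ 0; set u3 := u _ 0 => u_rel.
have [|c] := f3_reg u3.
  exists (fun i : 'I_2 => if i == ord0 then - u1 else - u2).
  rewrite !big_ord_recl big_ord0 /=.
  by apply/eqP; rewrite -subr_eq0 [X in _ == X]u_rel; apply/eqP; ring.
rewrite !big_ord_recl big_ord0 /= addr0.
set al := c _; set be := c _ => u3E.
have [|d] := f2_reg (u2 + be * f3).
  exists (fun=> - (u1 + al * f3)); rewrite big_ord1 /=.
  apply/eqP; rewrite -subr_eq0 [X in _ == X]u_rel u3E; apply/eqP; ring.
rewrite big_ord1 /=; set ga := d _ => u2E.
have u1E : u1 = - al * f3 - f2 * ga.
  apply: f1_reg; apply/eqP; rewrite -subr_eq0 [X in _ == X]u_rel; apply/eqP.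
  have -> : u2 = ga * f1 - be * f3 by rewrite -u2E addrK.
  by rewrite u3E; ring.
pose w : 'cV[A]_3 :=
  \col_i (if i == ord0 then be else if i == ord_max then ga else - al).
exists w; apply/matrixP => i j; rewrite (ord1 j).
have [K1 K2 K3] := koszul2M w 0.
elim/forall_ord3: i; rewrite ?K1 ?K2 ?K3 !mxE /=.
- by rewrite -/u1 u1E; ring.
- by rewrite -/u2 -[u2](addrK (be * f3)) u2E; ring.
- by rewrite -/u3 u3E; ring.
Qed.

Local Notation psi1 := (block_mx d1 (- a^T) 0 d2).
Local Notation psi2 := (block_mx d2 a 0 d3).

Lemma twisted_koszul_complex : psi1 *m psi2 = 0.
Proof.
rewrite mulmx_block koszul12 koszul23 koszul1_twist !mulmx0 !mul0mx mulNmx.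
by rewrite addrN !addr0 block_mx0.
Qed.

Lemma twisted_koszul_exact (v : 'cV[A]_(3 + 3)) :
  psi1 *m v = 0 <-> exists u, v = psi2 *m u.
Proof.
split=> [|[u ->]]; last by rewrite mulmxA twisted_koszul_complex mul0mx.
rewrite -[v]vsubmxK; set x := usubmx v; set y := dsubmx v.
rewrite mul_block_col mul0mx add0r -[0]col_mx0 => /eq_col_mx[d1x d2y].
have [c yE] := koszul2_exact _ d2y.
have [|w xE] := koszul1_exact (x - a *m c).
  by rewrite mulmxBr mulmxA koszul1_twist -mulmxA -yE -mulNmx.
exists (col_mx w c).
by rewrite mul_block_col mul0mx add0r -yE -xE subrK.
Qed.

Lemma tr_twisted_koszul_exact (v : 'cV[A]_(3 + 3)) :
  psi2^T *m v = 0 <-> exists u, v = psi1^T *m u.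
Proof.
split=> [|[u ->]]; last first.
  by rewrite mulmxA -trmx_mul twisted_koszul_complex trmx0 mul0mx.
rewrite !tr_block_mx !trmx0 tr_koszul1 tr_koszul3 !tr_koszul2.
rewrite [(- a^T)^T]raddfN /= trmxK.
rewrite -[v]vsubmxK; set x := usubmx v; set y := dsubmx v.
rewrite mul_block_col mul0mx addr0 -[0]col_mx0 => /eq_col_mx[d2x d1y].
have [|c xE] := koszul2_exact x.
  by apply: oppr_inj; rewrite -mulNmx oppr0.
have [|w yE] := koszul1_exact (y + a *m c).
  by rewrite mulmxDr mulmxA koszul1_twist -mulmxA -xE addrC.
exists (col_mx c (- w)).
rewrite mul_block_col mul0mx addr0 -xE !mulNmx mulmxN opprK -yE.
by rewrite [y + _]addrC addKr.
Qed.

End TwistedKoszul.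

Theorem twisted_koszul_code_topological (R : comNzRingType) (n : nat)
    (f1 f2 f3 : laurent R n) (a : 'cV[laurent R n]_3) :
  regular_sequence f1 f2 f3 ->
  css_code (twisted_koszul_code f1 f2 f3 a) /\
  topological (twisted_koszul_code f1 f2 f3 a).
Proof.
move=> reg; rewrite /css_code /topological /= /phiX daggerK.
split; first exact: twisted_koszul_complex.
split=> v; last by apply: iff_sym; apply: twisted_koszul_exact.
split=> [/mx_im_dagger v_im|/mx_ker_dagger v_ker].
  by apply/mx_ker_dagger; apply/(tr_twisted_koszul_exact reg).
by apply/mx_im_dagger; apply/(tr_twisted_koszul_exact reg).
Qed.

Theorem fact9 (N : nat) (hN : (2 <= N)%N)
    (f1 f2 f3 : laurent 'Z_N 3) (a : 'cV[laurent 'Z_N 3]_3) :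
  regular_sequence f1 f2 f3 ->
  css_code (twisted_koszul_code f1 f2 f3 a) /\
  topological (twisted_koszul_code f1 f2 f3 a).
Proof. exact: twisted_koszul_code_topological. Qed.
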